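(* Let $R$ be a Noetherian (resp. Artinian) ring which is a maximal subring of a ring $T$, with $(R:T)\neq 0$. Then the following hold: (1) $T/\mathrm{l.ann}_T((R:T)_l)$, and in particular $T/\mathrm{l.ann}_T((R:T))$, are left Noetherian (resp. left Artinian) rings. (2) $T/\mathrm{r.ann}_T((R:T)_r)$, and in particular $T/\mathrm{r.ann}_T((R:T))$, are right Noetherian (resp. right Artinian) rings. (3) If $T$ is semiprime, then $T/\mathrm{ann}_T((R:T))$ is a Noetherian (resp. an Artinian) ring. (4) If $T$ is a prime ring, then $T$ is finitely generated as a left and as a right $R$-module. In particular, $T$ is a Noetherian (resp. an Artinian) ring. Moreover, $(R:T)_l$ and $(R:T)_r$ are right and left primitive ideals of $R$, respectively.
   Context: All rings are associative, unital with $1\neq 0$, and not necessarily commutative; subrings contain the identity of the overring; modules are unital. Noetherian (resp. Artinian) without a side means both left and right Noetherian (resp. Artinian). A subring $R\subsetneq T$ is a maximal subring of $T$ if there is no subring $S$ with $R\subsetneq S\subsetneq T$. $(R:T):=\{x\in T\mid TxT\subseteq R\}$, $(R:T)_l:=\{x\in T\mid Tx\subseteq R\}$ and $(R:T)_r:=\{x\in T\mid xT\subseteq R\}$ are respectively the largest two-sided, left and right ideal of $T$ contained in $R$; all are two-sided ideals of $R$. For $X\subseteq T$, $\mathrm{l.ann}_T(X)=\{t\in T\mid tX=0\}$, $\mathrm{r.ann}_T(X)=\{t\in T\mid Xt=0\}$ and $\mathrm{ann}_T(X)=\mathrm{l.ann}_T(X)\cap \mathrm{r.ann}_T(X)$.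 A left (resp. right) primitive ideal is the annihilator of a simple left (resp. right) module. *)

(* Defs.v *)
From HB Require Import structures.
From mathcomp Require Import all_boot all_order all_algebra.
From mathcomp Require Import boolp.

Set Implicit Arguments.
Unset Strict Implicit.
Unset Printing Implicit Defensive.

Import GRing.Theory.

Local Open Scope ring_scope.

(* One-sided and two-sided ideals, as predicates closed under subtraction.
   Ideals are allowed to be improper: mathcomp's [idealr] is both one-sided
   and proper, and its ring quotient is limited to commutative rings. *)

HB.mixin Record isLeftIdeal (A : pzRingType) (S : A -> bool) := {
  left_ideal_closed : forall a x : A, x \in S -> a * x \in S
}.

#[short(type="leftIdeal")]
HB.structure Definition LeftIdeal (A : pzRingType) :=
  {S of GRing.ZmodClosed A S & isLeftIdeal A S}.

HB.mixin Record isRightIdeal (A : pzRingType) (S : A -> bool) := {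
  right_ideal_closed : forall a x : A, x \in S -> x * a \in S
}.

#[short(type="rightIdeal")]
HB.structure Definition RightIdeal (A : pzRingType) :=
  {S of GRing.ZmodClosed A S & isRightIdeal A S}.

#[short(type="twoSidedIdeal")]
HB.structure Definition TwoSidedIdeal (A : pzRingType) :=
  {S of LeftIdeal A S & RightIdeal A S}.

(* Chain conditions.  Rings satisfy 1 != 0; this is part of the predicates
   because they are applied to quotient rings, which [quotient_ring] below
   builds for improper ideals as well. *)

Definition left_noetherian (A : pzRingType) : Prop :=
  (1 : A) != 0 /\
  forall I : nat -> leftIdeal A,
    (forall n, {subset I n <= I n.+1}) ->
    exists n, forall m, (n <= m)%N -> I m =i I n.

Definition right_noetherian (A : pzRingType) : Prop :=
  (1 : A) != 0 /\
  forall I : nat -> rightIdeal A,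
    (forall n, {subset I n <= I n.+1}) ->
    exists n, forall m, (n <= m)%N -> I m =i I n.

Definition noetherian (A : pzRingType) : Prop :=
  left_noetherian A /\ right_noetherian A.

Definition left_artinian (A : pzRingType) : Prop :=
  (1 : A) != 0 /\
  forall I : nat -> leftIdeal A,
    (forall n, {subset I n.+1 <= I n}) ->
    exists n, forall m, (n <= m)%N -> I m =i I n.

Definition right_artinian (A : pzRingType) : Prop :=
  (1 : A) != 0 /\
  forall I : nat -> rightIdeal A,
    (forall n, {subset I n.+1 <= I n}) ->
    exists n, forall m, (n <= m)%N -> I m =i I n.

Definition artinian (A : pzRingType) : Prop :=
  left_artinian A /\ right_artinian A.

Definition semiprime_ring (A : nzRingType) : Prop :=
  forall I : twoSidedIdeal A,
    {in I &, forall x y, x * y = 0} -> {in I, forall x, x = 0}.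

Definition prime_ring (A : nzRingType) : Prop :=
  forall I J : twoSidedIdeal A,
    {in I & J, forall x y, x * y = 0} ->
    {in I, forall x, x = 0} \/ {in J, forall y, y = 0}.

Definition simple_module (A : pzRingType) (M : lmodType A) : Prop :=
  (exists x : M, x != 0) /\
  forall N : submodClosed M, N =i pred1 (0 : M) \/ N =i predT.

Definition left_primitive_ideal (A : pzRingType) (P : {pred A}) : Prop :=
  exists M : lmodType A, simple_module M /\
    forall a : A, a \in P <-> forall m : M, a *: m = 0.

(* Right A-modules are left modules over the converse ring A^c. *)
Definition right_primitive_ideal (A : pzRingType) (P : {pred A}) : Prop :=
  exists M : lmodType A^c, simple_module M /\
    forall a : A, a \in P <-> forall m : M, (a : A^c) *: m = 0.

Section SubringType.
Variables (T : nzRingType) (R : subringClosed T).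

Record subring_type := SubringElt {
  subring_val : T;
  subring_valP : subring_val \in R
}.

HB.instance Definition _ := [isSub for subring_val].
HB.instance Definition _ := [Choice of subring_type by <:].
HB.instance Definition _ :=
  [SubChoice_isSubNzRing of subring_type by <:].

End SubringType.

Definition maximal_subring (T : nzRingType) (R : subringClosed T) : Prop :=
  (exists x : T, x \notin R) /\
  forall S : subringClosed T, {subset R <= S} -> S =i R \/ S =i predT.

Section Conductors.
Variables (T : nzRingType) (R : subringClosed T).

Definition conductor : {pred T} :=
  fun x => `[< forall s t : T, s * x * t \in R >].
Definition l_conductor : {pred T} :=
  fun x => `[< forall t : T, t * x \in R >].
Definition r_conductor : {pred T} :=
  fun x => `[< forall t : T, x * t \in R >].

Fact conductor_zmod_closed : zmod_closed conductor.
Proof.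
split=> [|x y /asboolP xP /asboolP yP]; apply/asboolP => s t.
  by rewrite mulr0 mul0r rpred0.
by rewrite mulrBr mulrBl rpredB.
Qed.
HB.instance Definition _ := GRing.isZmodClosed.Build T conductor
  conductor_zmod_closed.
Fact conductor_left (a x : T) : x \in conductor -> a * x \in conductor.
Proof. by move=> /asboolP xP; apply/asboolP => s t; rewrite mulrA. Qed.
HB.instance Definition _ := isLeftIdeal.Build T conductor conductor_left.
Fact conductor_right (a x : T) : x \in conductor -> x * a \in conductor.
Proof.
by move=> /asboolP xP; apply/asboolP => s t; rewrite mulrA -mulrA.
Qed.
HB.instance Definition _ := isRightIdeal.Build T conductor conductor_right.

Fact l_conductor_zmod_closed : zmod_closed l_conductor.
Proof.
split=> [|x y /asboolP xP /asboolP yP]; apply/asboolP => t.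
  by rewrite mulr0 rpred0.
by rewrite mulrBr rpredB.
Qed.
HB.instance Definition _ := GRing.isZmodClosed.Build T l_conductor
  l_conductor_zmod_closed.
Fact l_conductor_left (a x : T) : x \in l_conductor -> a * x \in l_conductor.
Proof. by move=> /asboolP xP; apply/asboolP => t; rewrite mulrA. Qed.
HB.instance Definition _ := isLeftIdeal.Build T l_conductor l_conductor_left.

Fact r_conductor_zmod_closed : zmod_closed r_conductor.
Proof.
split=> [|x y /asboolP xP /asboolP yP]; apply/asboolP => t.
  by rewrite mul0r rpred0.
by rewrite mulrBl rpredB.
Qed.
HB.instance Definition _ := GRing.isZmodClosed.Build T r_conductor
  r_conductor_zmod_closed.
Fact r_conductor_right (a x : T) : x \in r_conductor -> x * a \in r_conductor.
Proof. by move=> /asboolP xP; apply/asboolP => t; rewrite -mulrA. Qed.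
HB.instance Definition _ := isRightIdeal.Build T r_conductor r_conductor_right.

End Conductors.

Definition l_ann (T : pzRingType) (X : {pred T}) : {pred T} :=
  fun t => `[< {in X, forall x, t * x = 0} >].
Definition r_ann (T : pzRingType) (X : {pred T}) : {pred T} :=
  fun t => `[< {in X, forall x, x * t = 0} >].
Definition ann (T : pzRingType) (X : {pred T}) : {pred T} :=
  fun t => (t \in l_ann X) && (t \in r_ann X).

(* The left annihilator of a left ideal, the right annihilator of a right
   ideal and the annihilator of a two-sided ideal are two-sided ideals. *)

Section Annihilators.
Variable T : pzRingType.

Fact l_ann_zmod_closed (X : {pred T}) : zmod_closed (l_ann X).
Proof.
split=> [|s t /asboolP sP /asboolP tP]; apply/asboolP => x xX.
  by rewrite mul0r.
by rewrite mulrBl sP ?tP ?subr0.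
Qed.
HB.instance Definition _ (X : {pred T}) := GRing.isZmodClosed.Build T (l_ann X)
  (l_ann_zmod_closed X).
Fact l_ann_left (X : {pred T}) (a t : T) : t \in l_ann X -> a * t \in l_ann X.
Proof.
by move=> /asboolP tP; apply/asboolP => x xX; rewrite -mulrA tP ?mulr0.
Qed.
HB.instance Definition _ (X : {pred T}) := isLeftIdeal.Build T (l_ann X)
  (@l_ann_left X).
Fact l_ann_right (X : leftIdeal T) (a t : T) :
  t \in l_ann X -> t * a \in l_ann X.
Proof.
move=> /asboolP tP; apply/asboolP => x xX.
by rewrite -mulrA tP ?left_ideal_closed.
Qed.
HB.instance Definition _ (X : leftIdeal T) := isRightIdeal.Build T (l_ann X)
  (@l_ann_right X).

Fact r_ann_zmod_closed (X : {pred T}) : zmod_closed (r_ann X).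
Proof.
split=> [|s t /asboolP sP /asboolP tP]; apply/asboolP => x xX.
  by rewrite mulr0.
by rewrite mulrBr sP ?tP ?subr0.
Qed.
HB.instance Definition _ (X : {pred T}) := GRing.isZmodClosed.Build T (r_ann X)
  (r_ann_zmod_closed X).
Fact r_ann_right (X : {pred T}) (a t : T) : t \in r_ann X -> t * a \in r_ann X.
Proof.
by move=> /asboolP tP; apply/asboolP => x xX; rewrite mulrA tP ?mul0r.
Qed.
HB.instance Definition _ (X : {pred T}) := isRightIdeal.Build T (r_ann X)
  (@r_ann_right X).
Fact r_ann_left (X : rightIdeal T) (a t : T) :
  t \in r_ann X -> a * t \in r_ann X.
Proof.
move=> /asboolP tP; apply/asboolP => x xX.
by rewrite mulrA tP ?right_ideal_closed.
Qed.
HB.instance Definition _ (X : rightIdeal T) := isLeftIdeal.Build T (r_ann X)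
  (@r_ann_left X).

Fact ann_zmod_closed (X : {pred T}) : zmod_closed (ann X).
Proof.
split=> [|s t /andP[sl sr] /andP[tl tr]]; apply/andP; split;
  by rewrite ?rpred0 ?rpredB.
Qed.
HB.instance Definition _ (X : {pred T}) := GRing.isZmodClosed.Build T (ann X)
  (ann_zmod_closed X).
Fact ann_left (X : twoSidedIdeal T) (a t : T) : t \in ann X -> a * t \in ann X.
Proof.
by move=> /andP[tl tr]; apply/andP; split; rewrite left_ideal_closed.
Qed.
HB.instance Definition _ (X : twoSidedIdeal T) := isLeftIdeal.Build T (ann X)
  (@ann_left X).
Fact ann_right (X : twoSidedIdeal T) (a t : T) : t \in ann X -> t * a \in ann X.
Proof.
by move=> /andP[tl tr]; apply/andP; split; rewrite right_ideal_closed.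
Qed.
HB.instance Definition _ (X : twoSidedIdeal T) := isRightIdeal.Build T (ann X)
  (@ann_right X).

End Annihilators.

Section QuotientRing.
Local Open Scope quotient_scope.
Variables (T : pzRingType) (I : twoSidedIdeal T).

Definition quotient_ring : Type := Quotient.quot I.

HB.instance Definition _ := GRing.Zmodule.on quotient_ring.
HB.instance Definition _ := EqQuotient.on quotient_ring.

Definition quotient_one : quotient_ring := \pi_quotient_ring (1 : T).
Definition quotient_mul (x y : quotient_ring) : quotient_ring :=
  \pi_quotient_ring (repr x * repr y).

Fact quotient_ring_eqP (x y : T) :
  reflect (\pi_quotient_ring x = \pi_quotient_ring y) (x - y \in I).
Proof. by rewrite Quotient.idealrBE; apply: eqP. Qed.

Fact quotient_ring_piM (x y : T) :
  \pi_quotient_ring (x * y) =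
  quotient_mul (\pi_quotient_ring x) (\pi_quotient_ring y).
Proof.
apply/quotient_ring_eqP.
have rE z : z - repr (\pi_quotient_ring z) \in I.
  by apply/quotient_ring_eqP; rewrite reprK.
set x' := repr _; set y' := repr _.
have -> : x * y - x' * y' = (x - x') * y + x' * (y - y').
  by rewrite mulrBl mulrBr addrA subrK.
by apply: rpredD; [apply: right_ideal_closed | apply: left_ideal_closed];
  apply: rE.
Qed.

Fact quotient_ring_piD (x y : T) :
  \pi_quotient_ring (x + y) = \pi_quotient_ring x + \pi_quotient_ring y.
Proof. exact: (Quotient.pi_add I). Qed.

Let mulA : associative quotient_mul.
Proof.
elim/quotW=> x; elim/quotW=> y; elim/quotW=> z.
by rewrite -(quotient_ring_piM y z) -(quotient_ring_piM x y)
  -(quotient_ring_piM x (y * z)) -(quotient_ring_piM (x * y) z) mulrA.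
Qed.
Let mul1x : left_id quotient_one quotient_mul.
Proof. by elim/quotW=> x; rewrite -quotient_ring_piM mul1r. Qed.
Let mulx1 : right_id quotient_one quotient_mul.
Proof. by elim/quotW=> x; rewrite -quotient_ring_piM mulr1. Qed.
Let mulDl : left_distributive quotient_mul +%R.
Proof.
elim/quotW=> x; elim/quotW=> y; elim/quotW=> z.
by rewrite -quotient_ring_piD -!quotient_ring_piM mulrDl quotient_ring_piD.
Qed.
Let mulDr : right_distributive quotient_mul +%R.
Proof.
elim/quotW=> x; elim/quotW=> y; elim/quotW=> z.
by rewrite -quotient_ring_piD -!quotient_ring_piM mulrDr quotient_ring_piD.
Qed.

HB.instance Definition _ := GRing.Zmodule_isPzRing.Build quotient_ring
  mulA mul1x mulx1 mulDl mulDr.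

End QuotientRing.

Definition left_fin_gen (T : nzRingType) (R : subringClosed T) : Prop :=
  exists (n : nat) (g : 'I_n -> T), forall t : T,
    exists c : 'I_n -> subring_type R, t = \sum_(i < n) val (c i) * g i.

Definition right_fin_gen (T : nzRingType) (R : subringClosed T) : Prop :=
  exists (n : nat) (g : 'I_n -> T), forall t : T,
    exists c : 'I_n -> subring_type R, t = \sum_(i < n) g i * val (c i).

(* Main.v *)
From HB Require Import structures.
Require Import Defs.
From mathcomp Require Import all_boot all_order all_algebra.
From mathcomp Require Import boolp classical_sets.

Set Implicit Arguments.
Unset Strict Implicit.
Unset Printing Implicit Defensive.

Import GRing.Theory.

Local Open Scope ring_scope.
Local Open Scope classical_set_scope.

(** Let [I] be a right ideal of [R] contained in [(R:T)_l], for instance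
    [(R:T)_l] itself or [(R:T)].  If [u_1, ..., u_n] generate [I] as a
    right ideal of [R], then [t] annihilates [I] on the left as soon as it
    annihilates the [u_i], so [T / l.ann_T(I)] embeds as a left [R]-module into
    [R^n] by [t |-> (t u_1, ..., t u_n)].  A chain condition on the left ideals
    of [R] thus passes to the left [R]-submodules of [T] that contain
    [l.ann_T(I)] ([chain_above_kernels], [left_restriction_chain]), hence to
    the left ideals of [T / l.ann_T(I)].  The right-hand statements are
    symmetric; right modules are left modules over the converse ring.

    The generators exist when [R] is right Noetherian, and also when it is
    right Artinian, by the Hopkins-Levitzki theorem ([dcc_fin_gen]); after this
    the Noetherian and Artinian cases are treated at once.

    If [T] is semiprime, the left and right annihilators of [(R:T)]
    coincide. If [T] is prime, both vanish since [(R:T)] is nonzero, so [T]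
    itself satisfies the chain condition as a left and as a right
    [R]-module. As [R] satisfies it too, the submodules of [T] are finitely
    generated and in particular satisfy the ascending chain condition. Let
    then [M] be maximal among the proper left [R]-submodules of [T] that
    contain [R]. The elements [s] with [s M <= M] form a subring containing
    [R], which is not [T] because [1] is in [M], so it is [R] by maximality
    of [R]. If [a T <= M], every [a t] lies in this subring, hence [a T <=
    R]: the annihilator of the simple module [T / M] is [(R:T)_r]. *)

(** * Submodules and chain conditions *)

Section Submodules.
Variables (A : pzRingType) (V : lmodType A).
Implicit Types (P Q K S : set V) (x y : V).

(** Submodules of [V] as sets, which makes sums, products, images and
    intersections of submodules immediate to form. *)
Definition submodule P : Prop :=
  P 0 /\ forall a x y, P x -> P y -> P (a *: x + y).

Lemma submodule0 P : submodule P -> P 0.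
Proof. by case. Qed.

Lemma submoduleZ P a x : submodule P -> P x -> P (a *: x).
Proof. by case=> P0 PD Px; rewrite -[_ *: _]addr0; apply: PD. Qed.

Lemma submoduleD P x y : submodule P -> P x -> P y -> P (x + y).
Proof. by case=> _ PD Px Py; rewrite -[x]scale1r; apply: PD. Qed.

Lemma submoduleB P x y : submodule P -> P x -> P y -> P (x - y).
Proof. by case=> _ PD Px Py; rewrite addrC -scaleN1r; apply: PD. Qed.

Lemma submodule_setI P Q : submodule P -> submodule Q -> submodule (P `&` Q).
Proof.
move=> [P0 PD] [Q0 QD]; split=> // a x y [Px Qx] [Py Qy].
by split; [apply: PD | apply: QD].
Qed.

(** The sum of two submodules. *)
Definition submodule_sum P Q : set V := [set x + y | x in P & y in Q].

Lemma submodule_sumP P Q : submodule P -> submodule Q ->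
  submodule (submodule_sum P Q).
Proof.
move=> [P0 PD] [Q0 QD]; split.
  by exists 0 => //; exists 0; rewrite ?addr0.
move=> a _ _ [x Px [y Qy <-]] [x' Px' [y' Qy' <-]].
exists (a *: x + x'); first exact: PD.
by exists (a *: y + y'); [exact: QD | rewrite scalerDr addrACA].
Qed.

Lemma submodule_suml P Q : submodule Q -> P `<=` submodule_sum P Q.
Proof. by case=> Q0 _ x Px; exists x => //; exists 0; rewrite ?addr0. Qed.

Lemma submodule_sumr P Q : submodule P -> Q `<=` submodule_sum P Q.
Proof. by case=> P0 _ x Qx; exists 0 => //; exists x; rewrite ?add0r. Qed.

Lemma submodule_sum_sub P Q K : submodule K -> P `<=` K -> Q `<=` K ->
  submodule_sum P Q `<=` K.
Proof.
move=> sK PK QK _ [x Px [y Qy <-]].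
by apply: submoduleD; [|apply: PK|apply: QK].
Qed.

(** The submodule generated by a set. *)
Definition submodule_gen S : set V :=
  [set x | forall Q, submodule Q -> S `<=` Q -> Q x].

Lemma submodule_genP S : submodule (submodule_gen S).
Proof.
split=> [Q [] //|a x y Sx Sy Q sQ SQ].
by case: (sQ) => _ QD; apply: QD; [apply: Sx | apply: Sy].
Qed.

Lemma sub_submodule_gen S : S `<=` submodule_gen S.
Proof. by move=> x Sx Q _; apply. Qed.

Lemma submodule_gen_sub S P : submodule P -> S `<=` P -> submodule_gen S `<=` P.
Proof. by move=> sP SP x; apply. Qed.

(** Finite generation of a submodule. *)
Definition fin_gen P : Prop := exists s : seq V, P = submodule_gen [set` s].

Lemma fin_gen_sum P Q : fin_gen P -> fin_gen Q -> fin_gen (submodule_sum P Q).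
Proof.
move=> [s ->] [t ->]; exists (s ++ t); apply/seteqP; split.
  by apply: submodule_sum_sub; [exact: submodule_genP| |];
    apply: submodule_gen_sub (submodule_genP _) _ => x /= xs;
    apply: sub_submodule_gen; rewrite /= mem_cat xs ?orbT.
apply: submodule_gen_sub; first by apply: submodule_sumP; exact: submodule_genP.
move=> x /=; rewrite mem_cat => /orP[xs|xt].
  by apply: submodule_suml; [exact: submodule_genP | exact: sub_submodule_gen].
by apply: submodule_sumr; [exact: submodule_genP | exact: sub_submodule_gen].
Qed.

Lemma submodule_line x : submodule [set a *: x | a in setT].
Proof.
split; first by exists 0; rewrite ?scale0r.
move=> a _ _ [b _ <-] [c _ <-]; exists (a * b + c) => //.
by rewrite scalerDl scalerA.
Qed.

Lemma fin_gen_line x : fin_gen [set a *: x | a in setT].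
Proof.
exists [:: x]; apply/seteqP; split=> [_ [a _ <-]|].
  apply: (submoduleZ a (submodule_genP _)).
  by apply: sub_submodule_gen; exact: mem_head.
apply: submodule_gen_sub; first exact: submodule_line.
by move=> y; rewrite /= inE => /eqP->; exists 1; rewrite ?scale1r.
Qed.

(** Members of the span of a sequence are linear combinations of its terms. *)
Lemma fin_genP (s : seq V) x : submodule_gen [set` s] x ->
  exists c : 'I_(size s) -> A, x = \sum_(i < size s) c i *: s`_i.
Proof.
pose Q := [set y : V |
  exists c : 'I_(size s) -> A, y = \sum_i c i *: s`_i].
move=> gx; suff: Q x by [].
apply: gx.
  split; first by exists (fun=> 0); rewrite big1 // => i _; rewrite scale0r.
  move=> a _ _ [c ->] [d ->]; exists (fun i => a * c i + d i).
  rewrite scaler_sumr -big_split /=; apply: eq_bigr => i _.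
  by rewrite scalerDl scalerA.
move=> y /= ys; have ltys : (index y s < size s)%N by rewrite index_mem.
exists (fun i => (i == Ordinal ltys)%:R).
rewrite (bigD1 (Ordinal ltys)) //= eqxx scale1r nth_index // big1 ?addr0 //.
by move=> i /negPf->; rewrite scale0r.
Qed.

(** [chain_step true] orders submodules by inclusion, [chain_step false] by
    reverse inclusion; the flag treats the ascending and the descending chain
    conditions simultaneously. *)
Definition chain_step (up : bool) P Q : Prop :=
  if up then P `<=` Q else Q `<=` P.

(** The ascending ([up = true]) or descending ([up = false]) chain condition
    for the submodules that contain [K]; [V] itself is Noetherian or Artinian
    when [K] is zero. *)
Definition chain_above (up : bool) K : Prop :=
  forall P : nat -> set V, (forall n, submodule (P n)) ->
    (forall n, K `<=` P n) -> (forall n, chain_step up (P n) (P n.+1)) ->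
    exists n, forall m, (n <= m)%N -> P m = P n.

Lemma chain_above_sub up K K' : K `<=` K' -> chain_above up K ->
  chain_above up K'.
Proof.
by move=> KK' cK P sP K'P; apply: cK => // n; apply: subset_trans (K'P n).
Qed.

(** Under a chain condition, every property that holds for some submodule has
    an extremal one: maximal when [up = true], minimal when [up = false]. *)
Lemma chain_extremal up K (F : set V -> Prop) P0 :
    chain_above up K -> submodule P0 -> K `<=` P0 -> F P0 ->
  exists P, [/\ submodule P, K `<=` P, F P &
    forall Q, submodule Q -> F Q -> K `<=` Q -> chain_step up P Q -> Q = P].
Proof.
move=> cK sP0 KP0 FP0; apply: contrapT => noext.
pose good P := [/\ submodule P, K `<=` P & F P].
have next (P : {P | good P}) :
    {Q : {Q | good Q} | chain_step up (sval P) (sval Q) /\ sval Q <> sval P}.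
  case: P => P [sP KP FP] /=; apply: cid; apply: contrapT => noQ; apply: noext.
  exists P; split=> // Q sQ FQ KQ PQ; apply: contrapT => QP; apply: noQ.
  by exists (exist good Q (And3 sQ KQ FQ)).
have [f [_ fS]] := dependent_choice next (exist good P0 (And3 sP0 KP0 FP0)).
have [n|n|n|n fn] := cK (fun n => sval (f n)); try by case: (svalP (f n)).
  by case: (fS n).
by case: (fS n) => _; apply; apply: fn (leqnSn n).
Qed.

(** The ascending chain condition amounts to the finite generation of all
    submodules; [fin_gen_acc] below is the converse. *)
Lemma acc_fin_gen P : chain_above true [set 0] -> submodule P -> fin_gen P.
Proof.
move=> acc sP; have s0 : submodule (submodule_gen [set` ([::] : seq V)]).
  exact: submodule_genP.
pose F Q := fin_gen Q /\ Q `<=` P.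
have FF : F (submodule_gen [set` ([::] : seq V)]).
  by split; [exists [::] | apply: submodule_gen_sub].
have [|Q [sQ _ [fQ QP] Qmax]] := chain_extremal acc s0 _ FF.
  by move=> _ ->; apply: submodule0.
suff -> : P = Q by [].
apply/seteqP; split=> // x Px.
have sl := submodule_line x.
rewrite -(Qmax (submodule_sum Q [set a *: x | a in setT])).
- by apply: submodule_sumr => //; exists 1; rewrite ?scale1r.
- exact: submodule_sumP.
- split; first by apply: fin_gen_sum fQ (fin_gen_line x).
  by apply: submodule_sum_sub => // _ [a _ <-]; apply: submoduleZ.
- by move=> _ ->; apply: submodule0; apply: submodule_sumP.
- exact: submodule_suml.
Qed.

Lemma fin_gen_acc : (forall P, submodule P -> fin_gen P) ->
  chain_above true [set 0].
Proof.
move=> fg P sP _ PS.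
have le_P n m : (n <= m)%N -> P n `<=` P m.
  move=> /subnKC <-; elim: (m - n)%N => [|k IHk]; first by rewrite addn0.
  by rewrite addnS; apply: subset_trans IHk (PS _).
have sU : submodule (\bigcup_n P n).
  split=> [|a x y [n _ Px] [m _ Py]]; first by exists 0%N => //; case: (sP 0%N).
  exists (maxn n m) => //; case: (sP (maxn n m)) => _; apply.
    by apply: le_P Px; rewrite leq_maxl.
  by apply: le_P Py; rewrite leq_maxr.
have [s Us] := fg _ sU.
have [n sPn] : exists n, [set` s] `<=` P n.
  have : [set` s] `<=` \bigcup_n P n by rewrite Us; apply: sub_submodule_gen.
  elim: s {Us} => [|x s IHs] sU'; first by exists 0%N.
  have [n sn|n sPn] := IHs; first by apply: sU'; rewrite /= inE sn orbT.
  have [|m _ Pmx] := sU' x; first exact: mem_head.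
  exists (maxn n m) => y; rewrite /= inE => /predU1P[->|/sPn Py].
    by apply: le_P Pmx; rewrite leq_maxr.
  by apply: le_P Py; rewrite leq_maxl.
exists n => m le_nm; apply/seteqP; split; last exact: le_P.
have Un : \bigcup_n P n `<=` P n by rewrite Us; apply: submodule_gen_sub.
by move=> x Px; apply: Un; exists m.
Qed.

End Submodules.

Arguments chain_above {A V} up K.

Lemma semilinear0 (A : pzRingType) (V W : lmodType A) (f : V -> W) :
  (forall a x y, f (a *: x + y) = a *: f x + f y) -> f 0 = 0.
Proof.
by move=> lin; rewrite -[0 in LHS](addNr 0) -scaleN1r lin scaleN1r addNr.
Qed.

(** Chain conditions lift from [W] to [V] modulo the common kernel of finitely
    many linear maps [V -> W]. *)
Lemma chain_above_kernels (A : pzRingType) (V W : lmodType A) (U : eqType)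
    (f : U -> V -> W) (s : seq U) up :
    chain_above up [set 0 : W] ->
    {in s, forall u a x y, f u (a *: x + y) = a *: f u x + f u y} ->
  chain_above up [set x : V | {in s, forall u, f u x = 0}].
Proof.
move=> cW; elim: s => [|u s IHs] lin.
  move=> P sP KP _; exists 0%N => m _.
  by apply/seteqP; split=> x _; apply: KP => u.
have lin_u a x y : f u (a *: x + y) = a *: f u x + f u y.
  by apply: lin; rewrite mem_head.
have f0 : f u 0 = 0 by apply: semilinear0.
have {}IHs := IHs (fun v vs => lin v (@mem_behead _ (u :: s) v vs)).
set K' := (X in chain_above up X) in IHs; set K := (X in chain_above up X).
have sK' : submodule K'.
  split=> [v vs|a x y K'x K'y v vs].
    exact: semilinear0 (lin v (@mem_behead _ (u :: s) v vs)).
  by rewrite lin ?inE ?vs ?orbT // K'x // K'y // scaler0 addr0.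
pose ker := [set x | f u x = 0].
have sker : submodule ker.
  by split=> // a x y; rewrite /ker /= lin_u => -> ->; rewrite scaler0 addr0.
move=> P sP KP PS.
have sim n : submodule (f u @` P n).
  split; first by exists 0 => //; case: (sP n).
  move=> a _ _ [x Px <-] [y Py <-]; exists (a *: x + y) => //.
  by case: (sP n) => _; apply.
have ssum n : submodule (submodule_sum (P n `&` ker) K').
  by apply: submodule_sumP => //; apply: submodule_setI.
have [| |n1 im_n1] := cW (fun n => f u @` P n) sim.
- by move=> n _ ->; apply: submodule0.
- move=> n; have := PS n; rewrite /chain_step.
  by case: up {cW IHs PS} => PS; apply: image_subset.
have [| |n2 sum_n2] := IHs (fun n => submodule_sum (P n `&` ker) K') ssum.
- by move=> n; apply/submodule_sumr/submodule_setI.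
- move=> n; have := PS n; rewrite /chain_step.
  by case: up {cW IHs PS} => PS _ [x [Px kx] [y K'y <-]];
    exists x => //; try (by split=> //; apply: PS); exists y.
(* Modular law: as [ker `&` K' = K] is below [P n], the sum of [P n `&` ker]
   with [K'] determines [P n `&` ker]. *)
have ker_stab m n :
    submodule_sum (P m `&` ker) K' = submodule_sum (P n `&` ker) K' ->
    P m `&` ker `<=` P n.
  move=> Emn x [Px kx].
  have : submodule_sum (P m `&` ker) K' x by apply: submodule_suml.
  rewrite Emn => -[y [Py ky] [z K'z xE]]; rewrite -xE.
  apply: submoduleD => //; apply: KP => v; rewrite inE => /predU1P[->|].
    have -> : z = x - y by rewrite -xE addrC addKr.
    exact: (submoduleB sker).
  exact: K'z.
have stab m n : f u @` P m = f u @` P n ->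
    submodule_sum (P m `&` ker) K' = submodule_sum (P n `&` ker) K' ->
    chain_step up (P n) (P m) -> P m = P n.
  (* The larger of two nested submodules with the same image under [f u] and
     the same intersection with [ker] is contained in the smaller one. *)
  have sub m' n' : f u @` P m' = f u @` P n' ->
      submodule_sum (P m' `&` ker) K' = submodule_sum (P n' `&` ker) K' ->
      P n' `<=` P m' -> P m' `<=` P n'.
    move=> Ef Es nm x Px.
    have : (f u @` P m') (f u x) by exists x.
    rewrite Ef => -[y Py fyx]; rewrite -[x](subrK y); apply: submoduleD => //.
    apply: (ker_stab m' n') => //; split.
      by apply: submoduleB => //; apply: nm.
    by rewrite /ker /= -scaleN1r addrC lin_u fyx scaleN1r addNr.
  rewrite /chain_step; case: (up) => Ef Es mn; apply/seteqP; split=> //.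
    exact: sub.
  by apply: sub.
have steps n k : chain_step up (P n) (P (n + k)%N).
  elim: k => [|k]; first by rewrite addn0 /chain_step; case: (up).
  have := PS (n + k)%N; rewrite addnS /chain_step.
  by case: (up) => PS' IHk; apply: subset_trans; eassumption.
exists (maxn n1 n2) => m le_m; apply: stab.
- rewrite (im_n1 (maxn _ _)) ?leq_maxl // im_n1 //.
  by apply: leq_trans le_m; rewrite leq_maxl.
- rewrite (sum_n2 (maxn _ _)) ?leq_maxr // sum_n2 //.
  by apply: leq_trans le_m; rewrite leq_maxr.
- by have := steps (maxn n1 n2) (m - maxn n1 n2)%N; rewrite subnKC.
Qed.

(** * Artinian modules over left Artinian rings are Noetherian *)

Section HopkinsLevitzki.
Variable A : pzRingType.

Section ModuleProduct.
Variable V : lmodType A.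
Implicit Types (I J : set A^o) (X : set V).

(** The product [IX] of a left ideal [I] and a submodule [X]. *)
Definition submodule_mul I X : set V :=
  submodule_gen [set (a : A) *: x | a in I & x in X].

Lemma submodule_mulP I X : submodule (submodule_mul I X).
Proof. exact: submodule_genP. Qed.

Lemma mem_submodule_mul I X (a : A) x :
  I a -> X x -> submodule_mul I X (a *: x).
Proof. by move=> Ia Xx; apply: sub_submodule_gen; exists a => //; exists x. Qed.

Lemma submodule_mul_sub I X Y : submodule Y ->
  (forall (a : A) x, I a -> X x -> Y (a *: x)) -> submodule_mul I X `<=` Y.
Proof.
move=> sY IXY; apply: submodule_gen_sub => // _ [a Ia [x Xx <-]].
exact: IXY.
Qed.

(** The submodule [I x] for a left ideal [I]. *)
Definition submodule_act I x : set V := [set (a : A) *: x | a in (I : set A)].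

Lemma submodule_actP I x : submodule I -> submodule (submodule_act I x).
Proof.
case=> I0 ID; split; first by exists 0; rewrite ?scale0r.
move=> a _ _ [b Ib <-] [c Ic <-]; exists (a * b + c); first exact: ID.
by rewrite scalerDl scalerA.
Qed.

Lemma submodule_act_sub I X x : submodule X -> X x -> submodule_act I x `<=` X.
Proof. by move=> sX Xx _ [a _ <-]; apply: submoduleZ. Qed.

(** As [I] is a left ideal, [IX] is already the additive span of the products
    [a *: x], so additive properties of its elements may be checked on these. *)
Lemma submodule_mul_ind I X (Y : set V) : submodule I -> Y 0 ->
    (forall x y, Y x -> Y y -> Y (x + y)) ->
    (forall (a : A) x, I a -> X x -> Y (a *: x)) ->
  submodule_mul I X `<=` Y.
Proof.
move=> sI Y0 YD IXY x IXx; pose Z := [set z : V | forall c, Y (c *: z)].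
suff : Z x by move=> /(_ 1); rewrite scale1r.
move: x IXx; apply: submodule_mul_sub.
  split=> [c|a x y Zx Zy c]; first by rewrite scaler0.
  by rewrite scalerDr scalerA; apply: YD.
move=> a x Ia Xx c; rewrite scalerA.
by apply: IXY => //; apply: (submoduleZ c sI Ia).
Qed.

End ModuleProduct.

(** Over a left Artinian ring, every submodule of an Artinian module is
    finitely generated.  Otherwise let [X] be minimal among the submodules that
    are not finitely generated: as its proper submodules are, it is not the sum
    of two of them.  Take [L] minimal among the left ideals with [L X = X].
    Then [L] is also not a sum of two left ideals strictly below it, it is
    cyclic, and it has a largest proper left subideal [C], for which [C X] is a
    proper submodule of [X].  Choose [x] in [X] with [L x] not inside [C X], and
    let [Y] be maximal among the submodules between [C X] and [X] that meet
    [L x] inside [C X].  Then [X = Y + L x], which makes [X] equal to [Y] or to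
    the cyclic submodule [L x]; both are absurd. *)
Lemma dcc_fin_gen (V : lmodType A) (P : set V) :
  chain_above false [set 0 : A^o] -> chain_above false [set 0 : V] ->
  submodule P -> fin_gen P.
Proof.
move=> dccA dccV sP; apply: contrapT => nfP.
have zero_sub (M : lmodType A) (Q : set M) : submodule Q -> [set 0] `<=` Q.
  by move=> sQ _ ->; apply: submodule0.
have [X [sX _ nfX Xmin]] :=
  chain_extremal (F := fun Q => ~ fin_gen Q) dccV sP (zero_sub _ _ sP) nfP.
have hollowX Q1 Q2 : submodule Q1 -> submodule Q2 -> Q1 `<=` X -> Q2 `<=` X ->
    X `<=` submodule_sum Q1 Q2 -> Q1 = X \/ Q2 = X.
  move=> s1 s2 le1 le2 XQ; apply: contrapT => /not_orP[n1 n2]; apply: nfX.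
  have -> : X = submodule_sum Q1 Q2.
    by apply/seteqP; split=> //; apply: submodule_sum_sub.
  by apply: fin_gen_sum; apply: contrapT => nf;
    [apply: n1 | apply: n2]; apply: Xmin => //; apply: zero_sub.
have mulX1 : submodule_mul [set: A^o] X = X.
  apply/seteqP; split.
    by apply: submodule_mul_sub => // a x _; apply: submoduleZ.
  by move=> x Xx; rewrite -[x]scale1r; apply: mem_submodule_mul.
have sA : submodule [set: A^o] by [].
have [L [sL _ LX Lmin]] := chain_extremal
  (F := fun I => submodule_mul I X = X) dccA sA (zero_sub _ _ sA) mulX1.
have LX_sub (I : set A^o) : I `<=` L -> submodule_mul I X `<=` X.
  move=> IL; apply: submodule_mul_sub => // a x /IL La Xx.
  exact: submoduleZ.
have {}Lmin (I : set A^o) : submodule I -> I `<=` L ->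
    X `<=` submodule_mul I X -> I = L.
  move=> sI IL XI; apply: Lmin => //; last exact: zero_sub.
  by apply/seteqP; split=> //; apply: LX_sub.
have hollowL (I J : set A^o) : submodule I -> submodule J ->
    I `<=` L -> J `<=` L -> L `<=` submodule_sum I J -> I = L \/ J = L.
  move=> sI sJ IL JL LIJ.
  have [|||||XI|XJ] :=
      hollowX (submodule_mul I X) (submodule_mul J X);
    try exact: submodule_mulP; try exact: LX_sub.
  - rewrite -{1}LX; apply: submodule_mul_sub.
      by apply: submodule_sumP; apply: submodule_mulP.
    move=> a x /LIJ[b Ib [c Jc <-]] Xx; rewrite scalerDl.
    exists ((b : A) *: x); first exact: mem_submodule_mul.
    by exists ((c : A) *: x) => //; exact: mem_submodule_mul.
  - by left; apply: Lmin => //; rewrite XI.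
  - by right; apply: Lmin => //; rewrite XJ.
(* [L] is idempotent since [(L L) X = L (L X) = X]. *)
have LL : submodule_mul L L = L.
  apply: Lmin; first exact: submodule_mulP.
    by apply: submodule_mul_sub => // a b _; apply: submoduleZ.
  have sLLX := submodule_mulP (submodule_mul L L) X.
  have LLX (a : A) : L a ->
      X `<=` [set x | submodule_mul (submodule_mul L L) X (a *: x)].
    move=> La; rewrite -{1}LX; apply: submodule_mul_ind => //=.
    - by rewrite scaler0; apply: submodule0.
    - by move=> x y; rewrite scalerDr; apply: submoduleD.
    - move=> b x Lb Xx; rewrite scalerA.
      by apply: mem_submodule_mul => //; apply: (@mem_submodule_mul A^o).
  by rewrite -{1}LX; apply: submodule_mul_sub => // a x La; apply: LLX.
have LLb (b : A) : (forall a c : A, L a -> L c -> a * (c * b) = 0) ->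
    forall a : A, L a -> a * b = 0.
  move=> LLb0 a; rewrite -LL => LLa.
  suff: [set a : A^o | (a : A) * b = 0] a by [].
  apply: (submodule_mul_sub _ _ LLa).
    split=> [|d x y xb yb]; first by rewrite /= mul0r.
    by rewrite /= mulrDl -mulrA xb yb mulr0 addr0.
  by move=> d c Ld Lc; rewrite /= -mulrA LLb0.
(* A minimal left ideal [B] with [L B] nonzero has the form [L b], and any [e]
   in [L] with [e b = b] generates [L]: every [a] in [L] is the sum of [a e]
   and of [a - a e], which annihilates [b]. *)
pose F (B : set A^o) := exists a b : A, [/\ L a, B b & a * b <> 0].
have FL : F L.
  apply: contrapT => nF; apply: nfX.
  exists [::]; apply/seteqP; split; last by apply: submodule_gen_sub.
  rewrite -{1}LX; apply: submodule_mul_sub; first exact: submodule_genP.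
  move=> a x La _; suff -> : a = 0.
    by rewrite scale0r; apply: submodule0; apply: submodule_genP.
  rewrite -[a]mulr1; apply: LLb La => {}a c La Lc; rewrite mulr1.
  by apply: contrapT => ac; apply: nF; exists a, c.
have [B [sB _ [a0 [b [La0 Bb a0b]]] Bmin]] :=
  chain_extremal (F := F) dccA sL (zero_sub _ _ sL) FL.
have Lb : submodule_act L (b : A^o) = B.
  apply: Bmin.
  - exact: submodule_actP.
  - apply: contrapT => nLb; apply: a0b; apply: LLb La0 => a c La Lc.
    by apply: contrapT => acb; apply: nLb; exists a, (c * b);
      split=> //; exists c.
  - by apply: zero_sub; apply: submodule_actP.
  - exact: submodule_act_sub.
have [e Le eb] : exists2 e : A, L e & e * b = b.
  by have : B b by []; rewrite -{1}Lb => -[e Le eb]; exists e.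
pose K : set A^o := [set a : A | L a /\ a * b = 0].
have sK : submodule K.
  split; first by split; [exact: submodule0 | rewrite mul0r].
  move=> a x y [Lx xb] [Ly yb]; split; first by case: sL => _; apply.
  by rewrite mulrDl -mulrA xb yb mulr0 addr0.
have KL : K <> L by move=> KL; apply: a0b; move: La0; rewrite -KL => -[].
have Le_eq : submodule_act L (e : A^o) = L.
  have [||||||] // := hollowL (submodule_act L (e : A^o)) K.
  - exact: submodule_actP.
  - exact: submodule_act_sub.
  - by move=> a [].
  move=> a La; exists (a * e); first by exists a.
  exists (a - a * e); last by rewrite addrC subrK.
  split; last by rewrite mulrBl -mulrA eb subrr.
  by apply: submoduleB => //; apply: (submoduleZ a sL Le).
pose line (c : A) := submodule_act setT (c : A^o).
(* The elements of [L] that do not generate [L] form its largest proper left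
   subideal. *)
pose C : set A^o := [set c : A | L c /\ line c <> L].
have sC : submodule C.
  split.
    split=> [|L0]; first exact: submodule0.
    suff e0 : e = 0 by apply: a0b; rewrite -eb e0 mul0r mulr0.
    by have: line 0 e by [rewrite L0]; case=> a _ <-; rewrite scaler0.
  move=> a x y [Lx nx] [Ly ny]; split; first by case: sL => _; apply.
  move=> Lxy; have [] := hollowL _ _ (submodule_actP (x : A^o) sA)
    (submodule_actP (y : A^o) sA).
  - exact: submodule_act_sub.
  - exact: submodule_act_sub.
  - rewrite -Lxy => _ [c _ <-]; exists ((c * a) *: x); first by exists (c * a).
    by exists (c *: y); [exists c | rewrite scalerDr scalerA].
  - exact: nx.
  - exact: ny.
have CL : C `<=` L by move=> c [].
have subC (D : set A^o) : submodule D -> D `<=` L -> D <> L -> D `<=` C.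
  move=> sD DL nDL c Dc; split; first exact: DL.
  move=> cL; apply: nDL; apply/seteqP; split=> // d; rewrite -cL => -[a _ <-].
  exact: submoduleZ.
have nCL : C <> L.
  move=> CL'; have : C e by rewrite CL'.
  case=> _; apply; apply/seteqP; split; first exact: submodule_act_sub.
  by rewrite -{1}Le_eq => _ [a La <-]; exists a.
have sCX := submodule_mulP C X.
have [x Xx [a1 La1 nCXx]] : exists2 x, X x &
    exists2 a : A, L a & ~ submodule_mul C X (a *: x).
  apply: contrapT => nx; apply: nCL; apply: Lmin => //.
  rewrite -{1}LX; apply: submodule_mul_sub => // a x La Xx.
  by apply: contrapT => ax; apply: nx; exists x => //; exists a.
pose good (Y : set V) := [/\ submodule Y, submodule_mul C X `<=` Y, Y `<=` X &
  forall a : A, L a -> Y (a *: x) -> submodule_mul C X (a *: x)].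
(* The empty set is allowed so that empty chains have an upper bound. *)
have [G Gchain Gtot|Y [goodY Ymax]] :=
    @Zorn_bigcup V [set Y | Y = set0 \/ good Y].
  have [[Y0 [GY0 gY0]]|noG] := pselect (exists Y, G Y /\ good Y); last first.
    left; apply: bigcup0 => Y GY; case: (Gchain Y GY) => // gY.
    by case: noG; exists Y.
  have gG Y : G Y -> (exists y, Y y) -> good Y.
    by move=> GY [y Yy]; case: (Gchain Y GY) => // Y00; rewrite Y00 in Yy.
  right; split.
  - split; first by exists Y0 => //; apply: submodule0; case: gY0.
    move=> a y z [Y1 GY1 Yy] [Y2 GY2 Yz].
    have [le12|le21] := Gtot _ _ GY1 GY2.
      exists Y2 => //; have [[_ sY] _ _ _] := gG _ GY2 (ex_intro _ _ Yz).
      by apply: sY => //; apply: le12.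
    exists Y1 => //; have [[_ sY] _ _ _] := gG _ GY1 (ex_intro _ _ Yy).
    by apply: sY => //; apply: le21.
  - by move=> y CXy; exists Y0 => //; case: gY0 => _ + _ _; apply.
  - move=> y [Y1 GY1 Yy].
    by have [_ _ + _] := gG _ GY1 (ex_intro _ _ Yy); apply.
  - move=> a La [Y1 GY1 Yy].
    by have [_ _ _] := gG _ GY1 (ex_intro _ _ Yy); apply.
have {goodY} [sY CXY YX Yx] : good Y.
  case: goodY => // Y0; have gCX : good (submodule_mul C X).
    by split=> //; apply: LX_sub.
  case: (Ymax (submodule_mul C X)); last by right.
  by rewrite Y0; split=> // /(_ 0); apply; apply: submodule0.
pose Lx := submodule_act L x.
have sLx : submodule Lx by apply: submodule_actP.
have LxX : Lx `<=` X by apply: submodule_act_sub.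
have sYLx := submodule_sumP sY sLx.
have XYLx : X `<=` submodule_sum Y Lx.
  rewrite -{1}LX; apply: submodule_mul_sub => // a y La Xy.
  apply: contrapT => nay.
  (* Otherwise the [d] in [L] with [d y] in [Y + L x] form a proper left
     subideal, hence lie in [C], and [Y + L y] contradicts the choice of [Y]. *)
  pose D : set A^o := [set d : A | L d /\ submodule_sum Y Lx (d *: y)].
  have DC : D `<=` C.
    apply: subC => [|d []//|DL]; last first.
      by apply: nay; have : D a by [rewrite DL]; case.
    split.
      by split; [exact: submodule0 | rewrite scale0r; exact: submodule0].
    move=> c d d' [Ld Dd] [Ld' Dd']; split; first by case: sL => _; apply.
    by rewrite scalerDl -scalerA; case: sYLx => _; apply.
  pose Ly := submodule_act L y.
  have sLy : submodule Ly by apply: submodule_actP.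
  apply: (Ymax (submodule_sum Y Ly)).
    split; first exact: submodule_suml.
    move=> YLyY; apply: nay; apply: submodule_suml => //; apply: YLyY.
    by apply: submodule_sumr => //; exists a.
  right; split; first exact: submodule_sumP.
  - by apply: subset_trans CXY _; apply: submodule_suml.
  - by apply: submodule_sum_sub => //; apply: submodule_act_sub.
  - move=> c Lc [y' Yy' [_ [d Ld <-] yE]].
    apply: Yx => //; rewrite -yE; apply: submoduleD => //; apply: CXY.
    apply: mem_submodule_mul => //; apply: DC; split=> //.
    exists (- y'); first by rewrite -scaleN1r; apply: submoduleZ.
    by exists (c *: x); [exists c | rewrite -yE addKr].
have [YeqX|LxeqX] := hollowX Y Lx sY sLx YX LxX XYLx.
  by apply: nCXx; apply: Yx => //; rewrite YeqX; apply: submoduleZ.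
apply: nfX; rewrite -LxeqX.
suff -> : Lx = [set a *: (e *: x) | a in setT] by apply: fin_gen_line.
apply/seteqP; split=> _ [a aL <-].
  by move: aL; rewrite -Le_eq => -[c Lc <-]; exists c => //; rewrite scalerA.
by exists (a * e); [apply: (submoduleZ a sL Le) | rewrite scalerA].
Qed.

End HopkinsLevitzki.

(** If a ring and a module over it satisfy the same chain condition, ascending
    or descending, every submodule of the module is finitely generated. *)
Lemma chain_fin_gen (A : pzRingType) (V : lmodType A) up (P : set V) :
  chain_above up [set 0 : A^o] -> chain_above up [set 0 : V] ->
  submodule P -> fin_gen P.
Proof. by case: up => cA cV; [apply: acc_fin_gen | apply: dcc_fin_gen]. Qed.

(** * Chain conditions on ideals of rings *)

(** The ascending ([up = true]) or descending ([up = false]) chain condition on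
    the one-sided ideals of a nonzero ring; the two values of the flag are
    convertible to [left_noetherian] and [left_artinian], respectively to
    [right_noetherian] and [right_artinian]. *)
Definition left_ideal_chain (up : bool) (A : pzRingType) : Prop :=
  (1 : A) != 0 /\
  forall I : nat -> leftIdeal A,
    (forall n, if up then {subset I n <= I n.+1} else {subset I n.+1 <= I n}) ->
    exists n, forall m, (n <= m)%N -> I m =i I n.

Definition right_ideal_chain (up : bool) (A : pzRingType) : Prop :=
  (1 : A) != 0 /\
  forall I : nat -> rightIdeal A,
    (forall n, if up then {subset I n <= I n.+1} else {subset I n.+1 <= I n}) ->
    exists n, forall m, (n <= m)%N -> I m =i I n.

Section IdealOfSubmodule.
Variable A : pzRingType.

Section Left.
Variables (P : set A^o) (sP : submodule P).

(** The boolean predicate of a submodule of the regular left module; the proof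
    argument carries the ideal structure. *)
Definition left_ideal_pred of submodule P : A -> bool := fun x => `[< P x >].

Fact left_ideal_pred_zmod_closed : zmod_closed (left_ideal_pred sP).
Proof.
split=> [|x y /asboolP Px /asboolP Py]; apply/asboolP.
  exact: (submodule0 sP).
exact: (submoduleB sP Px Py).
Qed.
HB.instance Definition _ :=
  GRing.isZmodClosed.Build A (left_ideal_pred sP) left_ideal_pred_zmod_closed.

Fact left_ideal_pred_left (a x : A) :
  x \in left_ideal_pred sP -> a * x \in left_ideal_pred sP.
Proof. by move=> /asboolP Px; apply/asboolP; apply: (submoduleZ a sP Px). Qed.
HB.instance Definition _ :=
  isLeftIdeal.Build A (left_ideal_pred sP) left_ideal_pred_left.
End Left.

Section Right.
Variables (P : set (A^c)^o) (sP : submodule P).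

(** The same for a submodule of the regular right module. *)
Definition right_ideal_pred of submodule P : A -> bool := fun x => `[< P x >].

Fact right_ideal_pred_zmod_closed : zmod_closed (right_ideal_pred sP).
Proof.
split=> [|x y /asboolP Px /asboolP Py]; apply/asboolP.
  exact: (submodule0 sP).
exact: (submoduleB sP Px Py).
Qed.
HB.instance Definition _ :=
  GRing.isZmodClosed.Build A (right_ideal_pred sP) right_ideal_pred_zmod_closed.

Fact right_ideal_pred_right (a x : A) :
  x \in right_ideal_pred sP -> x * a \in right_ideal_pred sP.
Proof.
by move=> /asboolP Px; apply/asboolP; apply: (submoduleZ (a : A^c) sP Px).
Qed.
HB.instance Definition _ :=
  isRightIdeal.Build A (right_ideal_pred sP) right_ideal_pred_right.
End Right.

Lemma left_ideal_chain_above up :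
  left_ideal_chain up A -> chain_above up [set 0 : A^o].
Proof.
move=> [_ cA] P sP _ PS.
have [n|n stab] :=
    cA (fun n => LeftIdeal.clone A (left_ideal_pred (sP n)) _).
  have := PS n; rewrite /chain_step.
  by case: (up) => le_P x /asboolP Px; apply/asboolP; apply: le_P.
exists n => m /stab Emn; have {}Emn x : `[< P m x >] = `[< P n x >] := Emn x.
by apply/seteqP; split=> x /asboolP; rewrite (Emn, =^~ Emn) => /asboolP.
Qed.

Lemma right_ideal_chain_above up :
  right_ideal_chain up A -> chain_above up [set 0 : (A^c)^o].
Proof.
move=> [_ cA] P sP _ PS.
have [n|n stab] :=
    cA (fun n => RightIdeal.clone A (right_ideal_pred (sP n)) _).
  have := PS n; rewrite /chain_step.
  by case: (up) => le_P x /asboolP Px; apply/asboolP; apply: le_P.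
exists n => m /stab Emn; have {}Emn x : `[< P m x >] = `[< P n x >] := Emn x.
by apply/seteqP; split=> x /asboolP; rewrite (Emn, =^~ Emn) => /asboolP.
Qed.

End IdealOfSubmodule.

(** Left ideals of [B] pull back to submodules of [V] along a surjection [phi]
    that turns the action of [a] on [V] into left multiplication by [h a]. *)
Lemma left_ideal_chain_pull (A B : pzRingType) (V : lmodType A)
    (h : A -> B) (phi : V -> B) (K : set V) up :
    (1 : B) != 0 -> (forall b, exists v, phi v = b) -> phi 0 = 0 ->
    (forall a x y, phi (a *: x + y) = h a * phi x + phi y) ->
    (forall v, K v -> phi v = 0) -> chain_above up K ->
  left_ideal_chain up B.
Proof.
move=> nz surj phi0 lin phiK cK; split=> // I IS.
have [n|n v Kv|n|n stab] := cK (fun n => [set v | phi v \in I n]).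
- split=> [|a x y Ix Iy]; first by rewrite /= phi0 rpred0.
  by rewrite /= lin rpredD ?left_ideal_closed.
- by rewrite /= phiK ?rpred0.
- by have := IS n; rewrite /chain_step; case: (up) => le_I x /= /le_I.
exists n => m /stab/seteqP[le_mn le_nm] b; have [v <-] := surj b.
by apply/idP/idP => [/le_mn|/le_nm].
Qed.

Lemma right_ideal_chain_pull (A B : pzRingType) (V : lmodType A)
    (h : A -> B) (phi : V -> B) (K : set V) up :
    (1 : B) != 0 -> (forall b, exists v, phi v = b) -> phi 0 = 0 ->
    (forall a x y, phi (a *: x + y) = phi x * h a + phi y) ->
    (forall v, K v -> phi v = 0) -> chain_above up K ->
  right_ideal_chain up B.
Proof.
move=> nz surj phi0 lin phiK cK; split=> // I IS.
have [n|n v Kv|n|n stab] := cK (fun n => [set v | phi v \in I n]).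
- split=> [|a x y Ix Iy]; first by rewrite /= phi0 rpred0.
  by rewrite /= lin rpredD ?right_ideal_closed.
- by rewrite /= phiK ?rpred0.
- by have := IS n; rewrite /chain_step; case: (up) => le_I x /= /le_I.
exists n => m /stab/seteqP[le_mn le_nm] b; have [v <-] := surj b.
by apply/idP/idP => [/le_mn|/le_nm].
Qed.

(** * The overring as a module over the subring *)

(** [T] as a left [R]-module and, in the guise of a left module over the
    converse ring of [R], as a right [R]-module. *)
Definition left_restriction (T : nzRingType) (R : subringClosed T) : Type := T.
Definition right_restriction (T : nzRingType) (R : subringClosed T) : Type := T.

Section Restriction.
Variables (T : nzRingType) (R : subringClosed T).
Notation A := (subring_type R).

HB.instance Definition _ := GRing.Zmodule.copy (left_restriction R) T.
HB.instance Definition _ := GRing.Zmodule.copy (right_restriction R) T.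

Let lscale (a : A) (x : left_restriction R) : left_restriction R :=
  val a * (x : T).
Let rscale (a : A^c) (x : right_restriction R) : right_restriction R :=
  (x : T) * val (a : A).

Fact lscalerA a b x : lscale a (lscale b x) = lscale (a * b) x.
Proof. by rewrite /lscale mulrA. Qed.
Fact lscale1r : left_id 1 lscale.
Proof. by move=> x; rewrite /lscale mul1r. Qed.
Fact lscalerDr : right_distributive lscale +%R.
Proof. by move=> a x y; rewrite /lscale mulrDr. Qed.
Fact lscalerDl x : {morph lscale^~ x : a b / a + b}.
Proof. by move=> a b; rewrite /lscale mulrDl. Qed.
HB.instance Definition _ := GRing.Zmodule_isLmodule.Build A (left_restriction R)
  lscalerA lscale1r lscalerDr lscalerDl.

Fact rscalerA a b x : rscale a (rscale b x) = rscale (a * b) x.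
Proof. by rewrite /rscale -mulrA. Qed.
Fact rscale1r : left_id 1 rscale.
Proof. by move=> x; rewrite /rscale mulr1. Qed.
Fact rscalerDr : right_distributive rscale +%R.
Proof. by move=> a x y; rewrite /rscale mulrDl. Qed.
Fact rscalerDl x : {morph rscale^~ x : a b / a + b}.
Proof. by move=> a b; rewrite /rscale mulrDr. Qed.
HB.instance Definition _ := GRing.Zmodule_isLmodule.Build A^c
  (right_restriction R) rscalerA rscale1r rscalerDr rscalerDl.

Lemma l_conductor_sub : {subset l_conductor R <= R}.
Proof. by move=> x /asboolP/(_ 1); rewrite mul1r. Qed.

Lemma r_conductor_sub : {subset r_conductor R <= R}.
Proof. by move=> x /asboolP/(_ 1); rewrite mulr1. Qed.

Lemma conductor_sub_l : {subset conductor R <= l_conductor R}.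
Proof.
by move=> x /asboolP xR; apply/asboolP => t; have := xR t 1; rewrite mulr1.
Qed.

Lemma conductor_sub_r : {subset conductor R <= r_conductor R}.
Proof.
by move=> x /asboolP xR; apply/asboolP => t; have := xR 1 t; rewrite mul1r.
Qed.

(** Finitely many generators of [X] as a right ideal of [R] have the same left
    annihilator in [T] as [X]. *)
Lemma l_ann_fin up (X : zmodClosed T) : right_ideal_chain up A ->
    {subset X <= R} -> (forall x (a : A), x \in X -> x * val a \in X) ->
  exists s : seq A, {in s, forall u, val u \in X} /\
    forall t : T, {in s, forall u, t * val u = 0} -> t \in l_ann X.
Proof.
move=> cA XR XA; pose P : set (A^c)^o := [set u : A | val u \in X].
have sP : submodule P.
  split=> [|a x y Px Py]; first exact: (rpred0 X).
  by apply: (rpredD (XA _ _ Px) Py).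
have cA1 := right_ideal_chain_above cA.
have [s Ps] := chain_fin_gen cA1 cA1 sP; exists s; split=> [u us|t ts].
  by suff: P u by []; rewrite Ps; apply: sub_submodule_gen.
apply/asboolP => x xX; have : P (SubringElt (XR x xX)) by [].
rewrite Ps => gx; pose Q : set (A^c)^o := [set u : A | t * val u = 0].
suff: Q (SubringElt (XR x xX)) by [].
apply: gx => [|u us]; last exact: ts.
split=> [|a u v Qu Qv]; first exact: mulr0.
by rewrite /Q /= mulrDr [X in _ + X]Qv addr0 mulrA [X in X * _]Qu mul0r.
Qed.

Lemma r_ann_fin up (X : zmodClosed T) : left_ideal_chain up A ->
    {subset X <= R} -> (forall x (a : A), x \in X -> val a * x \in X) ->
  exists s : seq A, {in s, forall u, val u \in X} /\
    forall t : T, {in s, forall u, val u * t = 0} -> t \in r_ann X.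
Proof.
move=> cA XR XA; pose P : set A^o := [set u : A | val u \in X].
have sP : submodule P.
  split=> [|a x y Px Py]; first exact: (rpred0 X).
  by apply: (rpredD (XA _ _ Px) Py).
have cA1 := left_ideal_chain_above cA.
have [s Ps] := chain_fin_gen cA1 cA1 sP; exists s; split=> [u us|t ts].
  by suff: P u by []; rewrite Ps; apply: sub_submodule_gen.
apply/asboolP => x xX; have : P (SubringElt (XR x xX)) by [].
rewrite Ps => gx; pose Q : set A^o := [set u : A | val u * t = 0].
suff: Q (SubringElt (XR x xX)) by [].
apply: gx => [|u us]; last exact: ts.
split=> [|a u v Qu Qv]; first exact: mul0r.
by rewrite /Q /= mulrDl [X in _ + X]Qv addr0 -mulrA [X in _ * X]Qu mulr0.
Qed.

(** The maps [t |-> t * u], for [u] in [(R:T)_l], send [T] to [R], so the chain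
    condition of [R] lifts to [T] modulo their common kernel. *)
Lemma left_restriction_chain up (s : seq A) : left_ideal_chain up A ->
    {in s, forall u, val u \in l_conductor R} ->
  chain_above up
    [set t : left_restriction R | {in s, forall u, (t : T) * val u = 0}].
Proof.
move=> cA sl.
(* The default value [0] is irrelevant, as [t * val u] is in [R]. *)
pose f (u : A) (t : left_restriction R) : A^o :=
  insubd (0 : A) ((t : T) * val u).
have val_f u t : u \in s -> val (f u t : A) = (t : T) * val u.
  by move=> /sl/asboolP ul; rewrite /f insubdK.
apply: (chain_above_sub (K := [set t | {in s, forall u, f u t = 0}])).
  by move=> t ft u us; rewrite -val_f // ft.
apply: chain_above_kernels (left_ideal_chain_above cA) _ => u us a x y.
apply: (@val_inj _ _ A); rewrite [LHS]val_f //.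
rewrite -[RHS]/(val a * val (f u x : A) + val (f u y : A)) !val_f //.
by rewrite mulrA -mulrDl.
Qed.

Lemma right_restriction_chain up (s : seq A) : right_ideal_chain up A ->
    {in s, forall u, val u \in r_conductor R} ->
  chain_above up
    [set t : right_restriction R | {in s, forall u, val u * (t : T) = 0}].
Proof.
move=> cA sr.
(* The default value [0] is irrelevant, as [val u * t] is in [R]. *)
pose f (u : A) (t : right_restriction R) : (A^c)^o :=
  insubd (0 : A) (val u * (t : T)).
have val_f u t : u \in s -> val (f u t : A) = val u * (t : T).
  by move=> /sr/asboolP ur; rewrite /f insubdK.
apply: (chain_above_sub (K := [set t | {in s, forall u, f u t = 0}])).
  by move=> t ft u us; rewrite -val_f // ft.
apply: chain_above_kernels (right_ideal_chain_above cA) _ => u us a x y.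
apply: (@val_inj _ _ A); rewrite [LHS]val_f //.
rewrite -[RHS]/(val (f u x : A) * val (a : A) + val (f u y : A)) !val_f //.
by rewrite -mulrA -mulrDr.
Qed.

End Restriction.

Lemma quotient_ring_pi0 (T : pzRingType) (K : twoSidedIdeal T) :
  \pi_(quotient_ring K)%qT 0 = 0.
Proof.
have := quotient_ring_piD K 0 0; rewrite addr0 => /eqP.
by rewrite -subr_eq subrr eq_sym => /eqP.
Qed.

Lemma quotient_ring_pi_eq0 (T : pzRingType) (K : twoSidedIdeal T) (x : T) :
  x \in K -> \pi_(quotient_ring K)%qT x = 0.
Proof.
move=> Kx; rewrite -(quotient_ring_pi0 K); apply/(quotient_ring_eqP K).
by rewrite subr0.
Qed.

Lemma quotient_ring_neq0 (T : pzRingType) (K : twoSidedIdeal T) :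
  (1 : T) \notin K -> (1 : quotient_ring K) != 0.
Proof.
move=> nK1; apply/eqP; rewrite -(quotient_ring_pi0 K).
by move=> /(quotient_ring_eqP K); rewrite subr0; apply/negP.
Qed.

Section ConductorQuotients.
Variables (T : nzRingType) (R : subringClosed T).
Notation A := (subring_type R).

(** The core of the argument, for a right [R]-submodule [X] of [(R:T)_l] and
    any quotient of [T] by an ideal that contains [l.ann_T(X)]. *)
Lemma quotient_left_chain up (X : zmodClosed T) (K : twoSidedIdeal T) :
    left_ideal_chain up A -> right_ideal_chain up A ->
    {subset X <= l_conductor R} ->
    (forall x (a : A), x \in X -> x * val a \in X) ->
    {subset l_ann X <= K} -> (1 : T) \notin K ->
  left_ideal_chain up (quotient_ring K).
Proof.
move=> cl cr Xl XA annK nK1.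
have [||s [sX sann]] := l_ann_fin cr (X := X) => //.
  by move=> x /Xl; apply: l_conductor_sub.
have cT := left_restriction_chain cl (fun u us => Xl _ (sX u us)).
apply: (left_ideal_chain_pull
  (h := fun a : A => \pi_(quotient_ring K)%qT (val a))
  (phi := fun x : left_restriction R => \pi_(quotient_ring K)%qT (x : T))
  _ _ _ _ _ cT).
- exact: quotient_ring_neq0.
- by move=> b; exists (repr b); rewrite reprK.
- exact: quotient_ring_pi0.
- move=> a x y; rewrite -[RHS]/(quotient_mul _ _ + _) -quotient_ring_piM.
  by rewrite -quotient_ring_piD.
- by move=> t /sann/annK; apply: quotient_ring_pi_eq0.
Qed.

Lemma quotient_right_chain up (X : zmodClosed T) (K : twoSidedIdeal T) :
    left_ideal_chain up A -> right_ideal_chain up A ->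
    {subset X <= r_conductor R} ->
    (forall x (a : A), x \in X -> val a * x \in X) ->
    {subset r_ann X <= K} -> (1 : T) \notin K ->
  right_ideal_chain up (quotient_ring K).
Proof.
move=> cl cr Xr XA annK nK1.
have [||s [sX sann]] := r_ann_fin cl (X := X) => //.
  by move=> x /Xr; apply: r_conductor_sub.
have cT := right_restriction_chain cr (fun u us => Xr _ (sX u us)).
apply: (right_ideal_chain_pull
  (h := fun a : A^c => \pi_(quotient_ring K)%qT (val (a : A)))
  (phi := fun x : right_restriction R => \pi_(quotient_ring K)%qT (x : T))
  _ _ _ _ _ cT).
- exact: quotient_ring_neq0.
- by move=> b; exists (repr b); rewrite reprK.
- exact: quotient_ring_pi0.
- move=> a x y; rewrite -[RHS]/(quotient_mul _ _ + _) -quotient_ring_piM.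
  by rewrite -quotient_ring_piD.
- by move=> t /sann/annK; apply: quotient_ring_pi_eq0.
Qed.

End ConductorQuotients.

(** * Simple quotient modules *)

Section QuotientModule.
Local Open Scope quotient_scope.
Variables (A : pzRingType) (V : lmodType A) (M : set V) (sM : submodule M).

(** The boolean predicate of the submodule [M]; the proof argument carries the
    subgroup structure needed to form the quotient. *)
Definition submodule_pred of submodule M : V -> bool := fun x => `[< M x >].

Fact submodule_pred_closed : zmod_closed (submodule_pred sM).
Proof.
split=> [|x y /asboolP Mx /asboolP My]; apply/asboolP.
  exact: submodule0.
exact: submoduleB.
Qed.
HB.instance Definition _ :=
  GRing.isZmodClosed.Build V (submodule_pred sM) submodule_pred_closed.

(** The quotient module [V / M]. *)
Definition quotient_module : Type :=
  Quotient.quot (GRing.ZmodClosed.clone V (submodule_pred sM) _).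

HB.instance Definition _ := GRing.Zmodule.on quotient_module.
HB.instance Definition _ := EqQuotient.on quotient_module.

Lemma quotient_module_eqP (x y : V) :
  \pi_quotient_module x = \pi_quotient_module y <-> M (x - y).
Proof.
split=> [/eqP|Mxy]; last apply/eqP; rewrite -Quotient.idealrBE.
  by move=> /asboolP.
exact/asboolP.
Qed.

Lemma quotient_module_piD (x y : V) :
  \pi_quotient_module (x + y) = \pi_quotient_module x + \pi_quotient_module y.
Proof. exact: (@Quotient.pi_add V
  (GRing.ZmodClosed.clone V (submodule_pred sM) _)). Qed.

Definition quotient_module_scale (a : A) (x : quotient_module) :
  quotient_module := \pi_quotient_module (a *: repr x).

Lemma quotient_module_piZ a x :
  quotient_module_scale a (\pi_quotient_module x) =
  \pi_quotient_module (a *: x).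
Proof.
apply/quotient_module_eqP; rewrite -scalerBr; apply: submoduleZ => //.
by apply/quotient_module_eqP; rewrite reprK.
Qed.

Fact quotient_module_scalerA a b x : quotient_module_scale a
  (quotient_module_scale b x) = quotient_module_scale (a * b) x.
Proof.
move: x; elim/quotW=> x.
rewrite (quotient_module_piZ b x) (quotient_module_piZ (a * b) x).
by rewrite (quotient_module_piZ a (b *: x)) scalerA.
Qed.

Fact quotient_module_scale1r : left_id 1 quotient_module_scale.
Proof. by elim/quotW=> x; rewrite quotient_module_piZ scale1r. Qed.

Fact quotient_module_scalerDr : right_distributive quotient_module_scale +%R.
Proof.
move=> a; elim/quotW=> x; elim/quotW=> y.
by rewrite -quotient_module_piD (quotient_module_piZ a (x + y))
  (quotient_module_piZ a x) (quotient_module_piZ a y) scalerDr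
  quotient_module_piD.
Qed.

Fact quotient_module_scalerDl x :
  {morph quotient_module_scale^~ x : a b / a + b}.
Proof.
move: x; elim/quotW=> x a b.
by rewrite (quotient_module_piZ (a + b) x) (quotient_module_piZ a x)
  (quotient_module_piZ b x) scalerDl quotient_module_piD.
Qed.

HB.instance Definition _ := GRing.Zmodule_isLmodule.Build A quotient_module
  quotient_module_scalerA quotient_module_scale1r quotient_module_scalerDr
  quotient_module_scalerDl.

Lemma quotient_module_pi_linear a x y :
  \pi_quotient_module (a *: x + y) =
  a *: \pi_quotient_module x + \pi_quotient_module y.
Proof.
rewrite quotient_module_piD; congr (_ + _).
by rewrite -[RHS]/(quotient_module_scale a _) (quotient_module_piZ a x).
Qed.

Lemma quotient_module_pi0 : \pi_quotient_module 0 = 0.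
Proof.
have := quotient_module_piD 0 0; rewrite addr0 => /eqP.
by rewrite -subr_eq subrr eq_sym => /eqP.
Qed.

Lemma quotient_module_pi_eq0 x : \pi_quotient_module x = 0 <-> M x.
Proof. by rewrite -quotient_module_pi0 quotient_module_eqP subr0. Qed.

End QuotientModule.

(** The quotient [V / M] by a maximal submodule is simple, and its annihilator
    consists of the [a] with [a V] inside [M]. *)
Lemma maximal_submodule_simple (A : pzRingType) (V : lmodType A) (M : set V) :
    submodule M -> M <> setT ->
    (forall Q, submodule Q -> M `<=` Q -> Q = M \/ Q = setT) ->
  exists W : lmodType A, simple_module W /\
    forall a : A, (forall w : W, a *: w = 0) <-> (forall v : V, M (a *: v)).
Proof.
move=> sM nMT Mmax.
exists (quotient_module sM); split; first split.
- apply: contrapT => nx; apply: nMT; apply/seteqP; split=> // x _.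
  apply/quotient_module_pi_eq0/eqP; apply: contrapT => /negP x0.
  by apply: nx; exists (\pi_(quotient_module sM)%qT x).
- move=> S; pose Q := [set x | \pi_(quotient_module sM)%qT x \in S].
  have sQ : submodule Q.
    split=> [|a x y Qx Qy]; first by rewrite /Q /= quotient_module_pi0 rpred0.
    by rewrite /Q /= quotient_module_pi_linear rpredD ?rpredZ.
  have MQ : M `<=` Q.
    by move=> x /quotient_module_pi_eq0; rewrite /Q /= => ->; apply: rpred0.
  have [QM|QT] := Mmax Q sQ MQ; [left|right]; elim/quotW=> x.
    rewrite [RHS]inE; apply/idP/eqP => [Sx|->]; last exact: rpred0.
    by apply/quotient_module_pi_eq0; rewrite -QM.
  by rewrite [RHS]inE; have : Q x by [rewrite QT]; move->.
- move=> a; split=> [a0 v|Ma w].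
    apply/quotient_module_pi_eq0; rewrite -quotient_module_piZ.
    exact: a0.
  move: w; elim/quotW=> v; rewrite -[LHS]/(quotient_module_scale a _).
  by rewrite (quotient_module_piZ sM a v); apply/quotient_module_pi_eq0.
Qed.

(** * Conductors of a maximal subring as primitive ideals *)

Section Stabilizer.
Variables (T : nzRingType) (M : set T).
Variable MB : forall x y, M x -> M y -> M (x - y).

(** The subring of the elements that map the additive subgroup [M] into itself
    by left, respectively right, multiplication; the proof argument carries the
    subring structure. *)
Definition left_stabilizer of (forall x y, M x -> M y -> M (x - y)) :
    T -> bool :=
  fun s => `[< forall m, M m -> M (s * m) >].
Definition right_stabilizer of (forall x y, M x -> M y -> M (x - y)) :
    T -> bool :=
  fun s => `[< forall m, M m -> M (m * s) >].

Fact left_stabilizer_closed : subring_closed (left_stabilizer MB).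
Proof.
split=> [|x y /asboolP Sx /asboolP Sy|x y /asboolP Sx /asboolP Sy];
  apply/asboolP => m Mm.
- by rewrite mul1r.
- by rewrite mulrBl; apply: MB; [apply: Sx | apply: Sy].
- by rewrite -mulrA; apply/Sx/Sy.
Qed.
HB.instance Definition _ := GRing.isSubringClosed.Build T
  (left_stabilizer MB) left_stabilizer_closed.

Fact right_stabilizer_closed : subring_closed (right_stabilizer MB).
Proof.
split=> [|x y /asboolP Sx /asboolP Sy|x y /asboolP Sx /asboolP Sy];
  apply/asboolP => m Mm.
- by rewrite mulr1.
- by rewrite mulrBr; apply: MB; [apply: Sx | apply: Sy].
- by rewrite mulrA; apply/Sy/Sx.
Qed.
HB.instance Definition _ := GRing.isSubringClosed.Build T
  (right_stabilizer MB) right_stabilizer_closed.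
End Stabilizer.

Section Primitive.
Variables (T : nzRingType) (R : subringClosed T).
Hypothesis hmax : maximal_subring R.
Notation A := (subring_type R).

(** A maximal proper left [R]-submodule [M] of [T] above [R] has stabilizer
    [R], as the stabilizer is a subring containing [R] and not all of [T];
    hence the annihilator of [T/M] is [(R:T)_r]. *)
Lemma r_conductor_left_primitive :
    chain_above true [set 0 : left_restriction R] ->
  left_primitive_ideal [pred x : A | val x \in r_conductor R].
Proof.
move=> acc; pose P0 : set (left_restriction R) := [set x : T | x \in R].
have sP0 : submodule P0.
  split=> [|a x y Rx Ry]; first exact: rpred0.
  by apply: rpredD Ry; apply: rpredM => //; exact: valP.
pose F (Q : set (left_restriction R)) := P0 `<=` Q /\ Q <> setT.
have FP0 : F P0.
  split=> // P0T; case: hmax => -[x /negP[]].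
  by have : P0 x by rewrite P0T.
have [|M [sM _ [RM MT] Mmax]] := chain_extremal acc sP0 _ FP0.
  by move=> _ ->; apply: submodule0.
have [|W [sW annW]] := maximal_submodule_simple sM MT.
  move=> Q sQ MQ; have [->|QT] := pselect (Q = setT); [by right|left].
  apply: Mmax => //; first by split=> //; apply: subset_trans MQ.
  by move=> _ ->; apply: submodule0.
exists W; split=> // a; rewrite annW; split=> [/asboolP aR v|Ma].
  exact: (RM _ (aR v)).
pose MB x y := @submoduleB _ _ M x y sM.
pose S := GRing.SubringClosed.clone T (left_stabilizer (M := M) MB) _.
have [|SR|ST] := hmax.2 S.
- move=> r Rr; apply/asboolP => m Mm.
  exact: (submoduleZ (SubringElt Rr) sM Mm).
- apply/asboolP => t; rewrite -SR; apply/asboolP => m Mm.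
  by rewrite -mulrA; apply: Ma.
- case: MT; apply/seteqP; split=> // t _.
  have /asboolP/(_ 1) : (t : T) \in S by rewrite ST.
  by rewrite mulr1; apply; apply: RM; exact: rpred1.
Qed.

Lemma l_conductor_right_primitive :
    chain_above true [set 0 : right_restriction R] ->
  right_primitive_ideal [pred x : A | val x \in l_conductor R].
Proof.
move=> acc; pose P0 : set (right_restriction R) := [set x : T | x \in R].
have sP0 : submodule P0.
  split=> [|a x y Rx Ry]; first exact: rpred0.
  by apply: rpredD Ry; apply: rpredM => //; exact: valP.
pose F (Q : set (right_restriction R)) := P0 `<=` Q /\ Q <> setT.
have FP0 : F P0.
  split=> // P0T; case: hmax => -[x /negP[]].
  by have : P0 x by rewrite P0T.
have [|M [sM _ [RM MT] Mmax]] := chain_extremal acc sP0 _ FP0.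
  by move=> _ ->; apply: submodule0.
have [|W [sW annW]] := maximal_submodule_simple sM MT.
  move=> Q sQ MQ; have [->|QT] := pselect (Q = setT); [by right|left].
  apply: Mmax => //; first by split=> //; apply: subset_trans MQ.
  by move=> _ ->; apply: submodule0.
exists W; split=> // a; rewrite annW; split=> [/asboolP aR v|Ma].
  exact: (RM _ (aR v)).
pose MB x y := @submoduleB _ _ M x y sM.
pose S := GRing.SubringClosed.clone T (right_stabilizer (M := M) MB) _.
have [|SR|ST] := hmax.2 S.
- move=> r Rr; apply/asboolP => m Mm.
  exact: (submoduleZ (SubringElt Rr : A^c) sM Mm).
- apply/asboolP => t; rewrite -SR; apply/asboolP => m Mm.
  by rewrite mulrA; apply: Ma.
- case: MT; apply/seteqP; split=> // t _.
  have /asboolP/(_ 1) : (t : T) \in S by rewrite ST.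
  by rewrite mul1r; apply; apply: RM; exact: rpred1.
Qed.

End Primitive.

(** * Prime and semiprime rings *)

Section IdealIntersection.
Variables (T : pzRingType) (I J : twoSidedIdeal T).

(** The intersection of two two-sided ideals. *)
Definition ideal_setI : T -> bool := fun x => (x \in I) && (x \in J).

Fact ideal_setI_zmod_closed : zmod_closed ideal_setI.
Proof.
split=> [|x y /andP[xI xJ] /andP[yI yJ]]; apply/andP; first by rewrite !rpred0.
by rewrite !rpredB.
Qed.
HB.instance Definition _ :=
  GRing.isZmodClosed.Build T ideal_setI ideal_setI_zmod_closed.
Fact ideal_setI_left (a x : T) : x \in ideal_setI -> a * x \in ideal_setI.
Proof. by move=> /andP[xI xJ]; apply/andP; rewrite !left_ideal_closed. Qed.
HB.instance Definition _ := isLeftIdeal.Build T ideal_setI ideal_setI_left.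
Fact ideal_setI_right (a x : T) : x \in ideal_setI -> x * a \in ideal_setI.
Proof. by move=> /andP[xI xJ]; apply/andP; rewrite !right_ideal_closed. Qed.
HB.instance Definition _ := isRightIdeal.Build T ideal_setI ideal_setI_right.
End IdealIntersection.

Section SemiprimeAnn.
Variables (T : nzRingType) (I : twoSidedIdeal T).

(** With [J] the left annihilator of [I], the ideal [I `&` J] squares to zero,
    hence vanishes, and it contains [I J]. *)
Lemma semiprime_l_ann : semiprime_ring T -> {subset l_ann I <= ann I}.
Proof.
move=> sT t tI; apply/andP; split=> //; apply/asboolP => x xI.
pose J := TwoSidedIdeal.clone T (l_ann I) _.
pose IJ := TwoSidedIdeal.clone T (ideal_setI I J) _.
apply: (sT IJ).
  by move=> y z /andP[_ /asboolP Jy] /andP[Iz _]; apply: Jy.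
apply/andP; split; first exact: right_ideal_closed.
exact: (left_ideal_closed (s := J)).
Qed.

Lemma semiprime_r_ann : semiprime_ring T -> {subset r_ann I <= ann I}.
Proof.
move=> sT t tI; apply/andP; split=> //; apply/asboolP => x xI.
pose J := TwoSidedIdeal.clone T (r_ann I) _.
pose IJ := TwoSidedIdeal.clone T (ideal_setI I J) _.
apply: (sT IJ).
  by move=> y z /andP[Iy _] /andP[_ /asboolP Jz]; apply: Jz.
apply/andP; split; first exact: left_ideal_closed.
exact: (right_ideal_closed (s := J)).
Qed.

Lemma prime_l_ann x t :
  prime_ring T -> x \in I -> x != 0 -> t \in l_ann I -> t = 0.
Proof.
move=> pT xI /eqP x0 tI; have [|/(_ t tI)|I0] // :=
  pT (TwoSidedIdeal.clone T (l_ann I) _) I.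
  by move=> y z /asboolP Jy /Jy.
by case: x0; apply: I0.
Qed.

Lemma prime_r_ann x t :
  prime_ring T -> x \in I -> x != 0 -> t \in r_ann I -> t = 0.
Proof.
move=> pT xI /eqP x0 tI; have [|I0|/(_ t tI)] // :=
  pT I (TwoSidedIdeal.clone T (r_ann I) _).
  by move=> y z yI /asboolP Jz; apply: Jz.
by case: x0; apply: I0.
Qed.
End SemiprimeAnn.

(** * Chain conditions for the overring *)

Section Main.
Variables (T : nzRingType) (R : subringClosed T).
Hypothesis hcond : exists2 x : T, x \in conductor R & x != 0.
Notation A := (subring_type R).
Variable up : bool.
Hypotheses (cl : left_ideal_chain up A) (cr : right_ideal_chain up A).

Lemma one_notin_l_ann (X : {pred T}) : {subset conductor R <= X} ->
  (1 : T) \notin l_ann X.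
Proof.
case: hcond => x xI x0 IX; apply/negP => /asboolP/(_ x (IX x xI))/eqP.
by rewrite mul1r (negPf x0).
Qed.

Lemma one_notin_r_ann (X : {pred T}) : {subset conductor R <= X} ->
  (1 : T) \notin r_ann X.
Proof.
case: hcond => x xI x0 IX; apply/negP => /asboolP/(_ x (IX x xI))/eqP.
by rewrite mulr1 (negPf x0).
Qed.

Lemma quotient_l_ann_chain :
  left_ideal_chain up (quotient_ring (l_ann (l_conductor R))) /\
  left_ideal_chain up (quotient_ring (l_ann (conductor R))).
Proof.
split; [apply: (quotient_left_chain (X := l_conductor R) cl cr) |
        apply: (quotient_left_chain (X := conductor R) cl cr)] => //.
- move=> x a /asboolP xR; apply/asboolP => t; rewrite mulrA rpredM //.
  exact: valP.
- by apply: one_notin_l_ann; apply: conductor_sub_l.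
- exact: conductor_sub_l.
- by move=> x a; apply: right_ideal_closed.
- exact: one_notin_l_ann.
Qed.

Lemma quotient_r_ann_chain :
  right_ideal_chain up (quotient_ring (r_ann (r_conductor R))) /\
  right_ideal_chain up (quotient_ring (r_ann (conductor R))).
Proof.
split; [apply: (quotient_right_chain (X := r_conductor R) cl cr) |
        apply: (quotient_right_chain (X := conductor R) cl cr)] => //.
- move=> x a /asboolP xR; apply/asboolP => t; rewrite -mulrA rpredM //.
  exact: valP.
- by apply: one_notin_r_ann; apply: conductor_sub_r.
- exact: conductor_sub_r.
- by move=> x a; apply: left_ideal_closed.
- exact: one_notin_r_ann.
Qed.

Lemma quotient_ann_chain : semiprime_ring T ->
  left_ideal_chain up (quotient_ring (ann (conductor R))) /\
  right_ideal_chain up (quotient_ring (ann (conductor R))).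
Proof.
move=> sT; have nann : (1 : T) \notin ann (conductor R).
  by apply/negP => /andP[ann1 _]; move: ann1; apply/negP/one_notin_l_ann.
split; [apply: (quotient_left_chain (X := conductor R) cl cr) |
        apply: (quotient_right_chain (X := conductor R) cl cr)] => //.
- exact: conductor_sub_l.
- by move=> x a; apply: right_ideal_closed.
- exact: semiprime_l_ann.
- exact: conductor_sub_r.
- by move=> x a; apply: left_ideal_closed.
- exact: semiprime_r_ann.
Qed.

Lemma prime_left_restriction_chain : prime_ring T ->
  chain_above up [set 0 : left_restriction R].
Proof.
move=> pT; have [x xI x0] := hcond.
have [||s [sI sann]] := l_ann_fin cr (X := conductor R).
- by move=> y /conductor_sub_l/l_conductor_sub.
- by move=> y a; apply: right_ideal_closed.
apply: chain_above_sub (left_restriction_chain cl _) => [t /sann|u /sI].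
  exact: prime_l_ann pT xI x0.
exact: conductor_sub_l.
Qed.

Lemma prime_right_restriction_chain : prime_ring T ->
  chain_above up [set 0 : right_restriction R].
Proof.
move=> pT; have [x xI x0] := hcond.
have [||s [sI sann]] := r_ann_fin cl (X := conductor R).
- by move=> y /conductor_sub_r/r_conductor_sub.
- by move=> y a; apply: left_ideal_closed.
apply: chain_above_sub (right_restriction_chain cr _) => [t /sann|u /sI].
  exact: prime_r_ann pT xI x0.
exact: conductor_sub_r.
Qed.

Hypotheses (pT : prime_ring T) (hmax : maximal_subring R).

Lemma prime_left_fin_gen : left_fin_gen R.
Proof.
have [|s sT] := chain_fin_gen (P := [set: left_restriction R])
  (left_ideal_chain_above cl) (prime_left_restriction_chain pT); first by [].
exists (size s), (fun i => s`_i) => t.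
by apply: (@fin_genP _ (left_restriction R)); rewrite -sT.
Qed.

Lemma prime_right_fin_gen : right_fin_gen R.
Proof.
have [|s sT] := chain_fin_gen (P := [set: right_restriction R])
  (right_ideal_chain_above cr) (prime_right_restriction_chain pT); first by [].
exists (size s), (fun i => s`_i) => t.
by apply: (@fin_genP _ (right_restriction R)); rewrite -sT.
Qed.

Lemma prime_ideal_chains : left_ideal_chain up T /\ right_ideal_chain up T.
Proof.
split.
  apply: (left_ideal_chain_pull (h := val : A -> T)
    (phi := id : left_restriction R -> T) (oner_neq0 T) _ _ _ _
    (prime_left_restriction_chain pT)) => //.
  by move=> b; exists b.
apply: (right_ideal_chain_pull (h := (val : A -> T) : A^c -> T)
  (phi := id : right_restriction R -> T) (oner_neq0 T) _ _ _ _
  (prime_right_restriction_chain pT)) => //.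
by move=> b; exists b.
Qed.

Lemma prime_conductors_primitive :
  right_primitive_ideal [pred x : A | val x \in l_conductor R] /\
  left_primitive_ideal [pred x : A | val x \in r_conductor R].
Proof.
split.
  apply: l_conductor_right_primitive => //; apply: fin_gen_acc => P.
  exact: chain_fin_gen (right_ideal_chain_above cr)
    (prime_right_restriction_chain pT).
apply: r_conductor_left_primitive => //; apply: fin_gen_acc => P.
exact: chain_fin_gen (left_ideal_chain_above cl)
  (prime_left_restriction_chain pT).
Qed.

End Main.

Theorem theorem4p6 (T : nzRingType) (R : subringClosed T)
    (hmax : maximal_subring R)
    (hcond : exists2 x : T, x \in conductor R & x != 0) :
  (noetherian (subring_type R) ->
    [/\ left_noetherian (quotient_ring (l_ann (l_conductor R))) /\
        left_noetherian (quotient_ring (l_ann (conductor R))),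
        right_noetherian (quotient_ring (r_ann (r_conductor R))) /\
        right_noetherian (quotient_ring (r_ann (conductor R))),
        semiprime_ring T ->
          noetherian (quotient_ring (ann (conductor R)))
      & prime_ring T ->
          [/\ left_fin_gen R, right_fin_gen R, noetherian T,
              right_primitive_ideal
                [pred x : subring_type R | val x \in l_conductor R]
            & left_primitive_ideal
                [pred x : subring_type R | val x \in r_conductor R]]]) /\
  (artinian (subring_type R) ->
    [/\ left_artinian (quotient_ring (l_ann (l_conductor R))) /\
        left_artinian (quotient_ring (l_ann (conductor R))),
        right_artinian (quotient_ring (r_ann (r_conductor R))) /\
        right_artinian (quotient_ring (r_ann (conductor R))),
        semiprime_ring T ->
          artinian (quotient_ring (ann (conductor R)))
      & prime_ring T ->
          [/\ left_fin_gen R, right_fin_gen R, artinian T,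
              right_primitive_ideal
                [pred x : subring_type R | val x \in l_conductor R]
            & left_primitive_ideal
                [pred x : subring_type R | val x \in r_conductor R]]]).
Proof.
have main up : left_ideal_chain up (subring_type R) ->
    right_ideal_chain up (subring_type R) ->
    [/\ left_ideal_chain up (quotient_ring (l_ann (l_conductor R))) /\
        left_ideal_chain up (quotient_ring (l_ann (conductor R))),
        right_ideal_chain up (quotient_ring (r_ann (r_conductor R))) /\
        right_ideal_chain up (quotient_ring (r_ann (conductor R))),
        semiprime_ring T ->
          left_ideal_chain up (quotient_ring (ann (conductor R))) /\
          right_ideal_chain up (quotient_ring (ann (conductor R)))
      & prime_ring T ->
          [/\ left_fin_gen R, right_fin_gen R,
              left_ideal_chain up T /\ right_ideal_chain up T,
              right_primitive_ideal
                [pred x : subring_type R | val x \in l_conductor R]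
            & left_primitive_ideal
                [pred x : subring_type R | val x \in r_conductor R]]].
  move=> cl cr; split.
  - exact: quotient_l_ann_chain.
  - exact: quotient_r_ann_chain.
  - exact: quotient_ann_chain.
  move=> pT; have [rP lP] := prime_conductors_primitive hcond cl cr pT hmax.
  split=> //.
  - exact: (prime_left_fin_gen hcond cl cr pT).
  - exact: (prime_right_fin_gen hcond cl cr pT).
  - exact: (prime_ideal_chains hcond cl cr pT).
(* [noetherian] and [artinian] are the two instances of the chain flag. *)
by split=> -[cl cr]; [apply: (main true) | apply: (main false)].
Qed.
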